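(* Let $(R_1,\mathcal L_1)$ and $(R_2,\mathcal L_2)$ be sets with a language. Equip $R_1^k$ and $R_2^{k'}$ with $\mathcal L_1^{(k)}$ respectively $\mathcal L_2^{(k')}$. Let $d_1:R_1\to R_2$ and $d_2:R_1^k\to R_2^{k'}$ be maps. If $d_1$ is an injective Diophantine map and $d_2$ is given by a Diophantine expression in $d_1$, then $d_2$ is a Diophantine map.
   Context: A ''set with a language'' $(R,\mathcal L)$ is a set $R$ together with a language $\mathcal L$ (constants, functions, relations) with an interpretation in $R$; every language contains a constant $0$ and equality. Terms are built from constants and variables using functions of $\mathcal L$; basic formulas have the form $(t_1,\ldots,t_m)\in R'$ with $R'\in\mathcal L$ an $m$-ary relation (possibly equality) and $t_i$ terms. $S\subset R^m$ is Diophantine if $S=\{\vec x\in R^m\mid\exists\vec y\in R^l\ (f_1\wedge\cdots\wedge f_r)\}$ for some basic formulas $f_i$. A map $d:A\to B$ between sets with a language is a Diophantine map if the coordinatewise image $d(S)\subset B^m$ is Diophantine for all $m$ and all Diophantine $S\subset A^m$. The language $\mathcal L^{(k)}$ on $R^k$: each constant $c\in\mathcal L$ gives the constant $(c,0,\ldots,0)$; each $r$-ary function $f\in\mathcal L$ gives the $r$-ary function $(\vec x_1,\ldots,\vec x_r)\mapsto(f(x_{11},\ldots,x_{r1}),0,\ldots,0)$; each $r$-ary relation $S\in\mathcal L$ gives the $r$-ary relation $\{((x_1,\vec 0),\ldots,(x_r,\vec 0))\mid(x_1,\ldots,x_r)\in S\}$; and for $1\le i\le k$ there is the unary function $\pi_i(\vec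 x)=(x_i,0,\ldots,0)$; equality on $R^k$ is also available. $d_2:R_1^k\to R_2^{k'}$ is given by a Diophantine expression in $d_1:R_1\to R_2$ if there exist basic $\mathcal L_2$-formulas $f_1,\ldots,f_n$ and an $l'$ such that for all $\vec x\in R_1^k$, $\vec z\in R_2^{k'}$: $d_2(\vec x)=\vec z\iff\exists\vec y\in R_2^{l'},\ \forall1\le i\le n,\ f_i(d_1(\vec x),\vec y,\vec z)$, where $d_1(\vec x)=(d_1(x_1),\ldots,d_1(x_k))$. *)

(* Defs.v *)
From mathcomp Require Import all_boot.
From mathcomp Require Import classical_sets.

Set Implicit Arguments.
Unset Strict Implicit.
Unset Printing Implicit Defensive.

Local Open Scope classical_set_scope.

(* [(R ^ n)%type] is [{ffun 'I_n -> R}], the n-tuples of elements of [R]. *)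
Definition coordwise (A B : Type) (d : A -> B) (m : nat) (x : (A ^ m)%type) :
  (B ^ m)%type := [ffun i => d (x i)].

(* A language with its interpretation in [R]; [lfun n] and [lrel n] are the
   types of the function and relation symbols of arity [n]. *)
Record language (R : Type) := Language {
  lconst : Type;
  lfun : nat -> Type;
  lrel : nat -> Type;
  iconst : lconst -> R;
  ifun : forall n, lfun n -> (R ^ n)%type -> R;
  irel : forall n, lrel n -> set (R ^ n)%type;
  lzero : lconst;
  lequal : lrel 2;
  iequal : irel lequal = [set x | x ord0 = x ord_max]
}.

Section Formulas.
Variables (R : Type) (L : language R) (V : Type).

Inductive term : Type :=
| Var of V
| Const of lconst L
| App n of lfun L n & ('I_n -> term).

Inductive basic_formula : Type :=
| Basic n of lrel L n & ('I_n -> term).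

Fixpoint eval (e : V -> R) (t : term) : R :=
  match t with
  | Var v => e v
  | Const c => iconst c
  | App n f ts => ifun f [ffun i => eval e (ts i)]
  end.

Definition holds (e : V -> R) (f : basic_formula) : Prop :=
  let: Basic n r ts := f in irel r [ffun i => eval e (ts i)].

End Formulas.

Definition val2 (R : Type) (m l : nat) (x : (R ^ m)%type) (y : (R ^ l)%type)
  (v : 'I_m + 'I_l) : R :=
  match v with inl i => x i | inr j => y j end.

Definition val3 (R : Type) (m l n : nat) (x : (R ^ m)%type) (y : (R ^ l)%type)
  (z : (R ^ n)%type) (v : 'I_m + 'I_l + 'I_n) : R :=
  match v with inl u => val2 x y u | inr j => z j end.

Definition diophantine (R : Type) (L : language R) (m : nat)
  (S : set (R ^ m)%type) : Prop :=
  exists (l r : nat) (f : 'I_r -> basic_formula L ('I_m + 'I_l)%type),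
    S = [set x | exists y : (R ^ l)%type, forall i, holds (val2 x y) (f i)].

Definition diophantine_map (A B : Type) (LA : language A) (LB : language B)
  (d : A -> B) : Prop :=
  forall (m : nat) (S : set (A ^ m)%type),
    diophantine LA S -> diophantine LB (@coordwise A B d m @` S).

Section PowerLanguage.
Variables (R : Type) (L : language R) (k : nat).

(* x |-> (x, 0, ..., 0); meaningful only for [0 < k]. *)
Definition pad (x : R) : (R ^ k)%type :=
  [ffun i : 'I_k => if val i == 0 then x else iconst (lzero L)].

Inductive pow_fun : nat -> Type :=
| PowFun n of lfun L n : pow_fun n
| PowProj of 'I_k : pow_fun 1.

(* [PowRel (lequal L)] is equality restricted to the image of [pad], whence
   the separate symbol [PowEq] for equality on all of R^k. *)
Inductive pow_rel : nat -> Type :=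
| PowRel n of lrel L n : pow_rel n
| PowEq : pow_rel 2.

(* The default value is used only when [k = 0]. *)
Definition first_coord (x : (R ^ k)%type) : R :=
  if insub 0 is Some i then x i else iconst (lzero L).

Definition ipow_fun n (f : pow_fun n) : ((R ^ k) ^ n)%type -> (R ^ k)%type :=
  match f in pow_fun n return ((R ^ k) ^ n)%type -> (R ^ k)%type with
  | PowFun n f => fun x => pad (ifun f (coordwise first_coord x))
  | PowProj i => fun x => pad (x ord0 i)
  end.

Definition ipow_rel n (r : pow_rel n) : set ((R ^ k) ^ n)%type :=
  match r in pow_rel n return set ((R ^ k) ^ n)%type with
  | PowRel n r => @coordwise R (R ^ k)%type pad n @` irel r
  | PowEq => [set x | x ord0 = x ord_max]
  end.

Definition pow_language : language (R ^ k)%type :=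
  @Language (R ^ k)%type (lconst L) pow_fun pow_rel
    (fun c => pad (iconst c)) ipow_fun ipow_rel (lzero L) PowEq erefl.

End PowerLanguage.

Definition diophantine_expression (R1 R2 : Type) (L2 : language R2)
  (k k' : nat) (d1 : R1 -> R2) (d2 : (R1 ^ k)%type -> (R2 ^ k')%type) : Prop :=
  exists (n l' : nat)
    (f : 'I_n -> basic_formula L2 ('I_k + 'I_l' + 'I_k')%type),
    forall (x : (R1 ^ k)%type) (z : (R2 ^ k')%type),
      d2 x = z <->
      exists y : (R2 ^ l')%type,
        forall i, holds (val3 (coordwise d1 x) y z) (f i).

(* Main.v *)
Require Import Defs.
From mathcomp Require Import all_boot.
From mathcomp Require Import boolp classical_sets.

(** A point of [(R ^ k) ^ m] is the same thing as a family of elements of [R]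
    indexed by ['I_m * 'I_k], and Diophantine sets correspond under this
    flattening, in both directions.

    - Each coordinate of a term over the power language is a term over the base
      language in the coordinates of its variables ([eval_coord_term]), so the
      flattening of a Diophantine subset of [(R ^ k) ^ m] is Diophantine
      ([dioph_flatten]).
    - Conversely a term [t] over the base language is simulated over the power
      language by a term with value [(t, 0, ..., 0)], a coordinate [x_j] being
      accessed through the projection [pi_j] ([eval_lift_term]); hence a set
      with Diophantine flattening is Diophantine ([dioph_unflatten]).

    It thus suffices to show that the flattening of [d2 @` S] is Diophantine.
    That set consists of the [z] for which there are some [w] in the image under
    [d1] of the flattening of [S] and, for each [i], auxiliary values
    witnessing the formulas that define [d2] at the [i]-th blocks of [w] and
    [z].
    The first condition is Diophantine because [d1] is a Diophantine map, the
    second one is given by basic formulas, and Diophantine conditions are closed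
    under finite conjunctions and existential quantification. *)

Set Implicit Arguments.
Unset Strict Implicit.
Unset Printing Implicit Defensive.

Local Open Scope classical_set_scope.

(** * Renaming of variables *)

Section Renaming.
Variables (R : Type) (L : language R).

Fixpoint rename_term (V V' : Type) (s : V -> V') (t : term L V) : term L V' :=
  match t with
  | Var v => Var L (s v)
  | Const c => Const V' c
  | App n f ts => App f (fun i => rename_term s (ts i))
  end.

Definition rename_formula (V V' : Type) (s : V -> V') (f : basic_formula L V) :
  basic_formula L V' :=
  let: Basic n r ts := f in Basic r (fun i => rename_term s (ts i)).

Lemma eval_rename (V V' : Type) (s : V -> V') (e : V' -> R) (t : term L V) :
  eval e (rename_term s t) = eval (e \o s) t.
Proof.
elim: t => //= n f ts IH.
by congr ifun; apply/ffunP => i; rewrite !ffunE IH.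
Qed.

Lemma holds_rename (V V' : Type) (s : V -> V') (e : V' -> R)
    (f : basic_formula L V) :
  holds e (rename_formula s f) <-> holds (e \o s) f.
Proof.
case: f => n r ts /=.
by under eq_ffun do rewrite eval_rename.
Qed.

End Renaming.

(** * Diophantine conditions on finite families *)

(** The valuation of [V + W] that restricts to [e] and to [y]. *)
Definition join (R V W : Type) (e : V -> R) (y : W -> R) (v : V + W) : R :=
  match v with inl a => e a | inr b => y b end.

Lemma join_split (R V W : Type) (g : V + W -> R) :
  join (g \o inl) (g \o inr) = g.
Proof. by apply/funext; case. Qed.

(** Diophantine conditions on families of elements of [R] indexed by an
    arbitrary type [V]. The auxiliary variables and the formulas are indexed by
    finite types instead of ordinals, which spares the encoding of sums and
    products of index sets as ordinals. *)
Definition dioph (R : Type) (L : language R) (V : Type)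
    (P : (V -> R) -> Prop) : Prop :=
  exists (W I : finType) (f : I -> basic_formula L (V + W)),
    forall e, P e <-> exists y : W -> R, forall i, holds (join e y) (f i).

Section Dioph.
Variables (R : Type) (L : language R).

Lemma eq_dioph (V : Type) (P Q : (V -> R) -> Prop) :
  (forall e, P e <-> Q e) -> dioph L P -> dioph L Q.
Proof. by move=> PQ [W [I [f Pf]]]; exists W, I, f => e; rewrite -PQ. Qed.

Lemma dioph_holds (V : Type) (f : basic_formula L V) :
  dioph L (fun e => holds e f).
Proof.
exists void, unit, (fun=> rename_formula inl f) => e; split=> [h|[y /(_ tt)]].
  by exists (fun v : void => match v with end) => _; apply/holds_rename.
by move/holds_rename.
Qed.

Lemma dioph_rename (V V' : Type) (s : V -> V') (P : (V -> R) -> Prop) :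
  dioph L P -> dioph L (fun e => P (e \o s)).
Proof.
move=> [W [I [f Pf]]].
pose s' (v : V + W) : V' + W :=
  match v with inl a => inl (s a) | inr b => inr b end.
exists W, I, (fun i => rename_formula s' (f i)) => e; rewrite Pf.
have E y : join e y \o s' = join (e \o s) y by apply/funext; case.
by split=> -[y h]; exists y => i; move: (h i);
   [rewrite holds_rename E | move/holds_rename; rewrite E].
Qed.

Lemma dioph_forall (V : Type) (J : finType) (P : J -> (V -> R) -> Prop) :
  (forall j, dioph L (P j)) -> dioph L (fun e => forall j, P j e).
Proof.
(* The witnesses for all [j] are collected by a choice over [J]. *)
move=> /choice[W /choice[I Pf]].
have {}Pf j : exists f : I j -> basic_formula L (V + W j),
    forall e, P j e <-> exists y, forall i, holds (join e y) (f i).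
  exact: Pf.
have {Pf}[f Pf] : exists f : forall j, I j -> basic_formula L (V + W j),
    forall j e, P j e <-> exists y, forall i, holds (join e y) (f j i).
  by exists (fun j => projT1 (cid (Pf j))) => j; case: (cid (Pf j)).
pose s j (v : V + W j) : V + {j : J & W j} :=
  match v with inl a => inl a | inr b => inr (Tagged W b) end.
have E e y j : join e y \o s j = join e (fun b => y (Tagged W b)).
  by apply/funext; case.
exists {j : J & W j}, {j : J & I j},
  (fun i => rename_formula (@s (tag i)) (f (tag i) (tagged i))) => e.
split=> [h|[y h] j].
- have [y hy] : exists y : forall j, W j -> R,
      forall j i, holds (join e (y j)) (f j i).
    have g j : exists y, forall i, holds (join e y) (f j i) by apply/Pf.
    by exists (fun j => projT1 (cid (g j))) => j; case: (cid (g j)).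
  by exists (fun b => y (tag b) (tagged b)) => -[j i];
     apply/holds_rename; rewrite E; apply: hy.
- apply/Pf; exists (fun b => y (Tagged W b)) => i.
  by have /holds_rename := h (Tagged I i); rewrite E.
Qed.

Lemma dioph_and (V : Type) (P Q : (V -> R) -> Prop) :
  dioph L P -> dioph L Q -> dioph L (fun e => P e /\ Q e).
Proof.
move=> dP dQ.
apply: (@eq_dioph _ (fun e => forall b : bool, (if b then P else Q) e)).
  move=> e; split=> [h|[hP hQ] []] //.
  by split; [apply: (h true) | apply: (h false)].
by apply: dioph_forall => -[].
Qed.

Lemma dioph_exists (V : Type) (U : finType) (P : (V + U -> R) -> Prop) :
  dioph L P -> dioph L (fun e => exists u, P (join e u)).
Proof.
move=> [W [I [f Pf]]].
pose s (v : V + U + W) : V + (U + W) :=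
  match v with
  | inl (inl a) => inl a | inl (inr b) => inr (inl b) | inr c => inr (inr c)
  end.
have E e u y : join e (join u y) \o s = join (join e u) y.
  by apply/funext => -[[]|].
exists (U + W)%type, I, (fun i => rename_formula s (f i)) => e; split.
- move=> [u /Pf[y h]]; exists (join u y) => i.
  by apply/holds_rename; rewrite E.
- move=> [y h]; exists (y \o inl); apply/Pf; exists (y \o inr) => i.
  by have /holds_rename := h i; rewrite -{1}(join_split y) E.
Qed.

Lemma dioph_eval_eq (V : Type) (t t' : term L V) :
  dioph L (fun e => eval e t = eval e t').
Proof.
pose f := Basic (lequal L) (fun i : 'I_2 => if i == ord0 then t else t').
apply: (eq_dioph _ (dioph_holds f)) => e.
by rewrite /f /= iequal /= !ffunE.
Qed.

(** On families indexed by an ordinal, [dioph] is the usual notion. *)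
Lemma diophantineP (m : nat) (S : set (R ^ m)%type) :
  diophantine L S <-> dioph L (fun e : 'I_m -> R => S [ffun i => e i]).
Proof.
split=> [[l [r [f ->]]]|[W [I [f Sf]]]].
  exists 'I_l, 'I_r, f => e; split=> -[y h].
  - exists y => i; suff -> : join e y = val2 [ffun i => e i] y by [].
    by apply/funext => -[a|b] //=; rewrite ffunE.
  - exists [ffun i => y i] => i.
    suff -> : val2 [ffun i => e i] [ffun i => y i] = join e y by [].
    by apply/funext => -[a|b] //=; rewrite ffunE.
pose s (v : 'I_m + W) : 'I_m + 'I_#|W| :=
  match v with inl a => inl a | inr b => inr (enum_rank b) end.
exists #|W|, #|I|, (fun i => rename_formula s (f (enum_val i))).
apply/seteqP; split=> x /=.
- have {1}-> : x = [ffun i => x i] by apply/ffunP => i; rewrite ffunE.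
  move=> /Sf[y h]; exists [ffun j => y (enum_val j)] => i.
  apply/holds_rename.
  suff -> : val2 x [ffun j => y (enum_val j)] \o s = join x y by [].
  by apply/funext => -[a|b] //=; rewrite ffunE enum_rankK.
- move=> [y h].
  have -> : x = [ffun i => x i] by apply/ffunP => i; rewrite ffunE.
  apply/Sf; exists (y \o enum_rank) => i.
  have /holds_rename := h (enum_rank i); rewrite enum_rankK.
  suff -> : val2 x y \o s = join x (y \o enum_rank) by [].
  by apply/funext; case.
Qed.

End Dioph.

(** A Diophantine map preserves Diophantine conditions on families indexed by
    any finite type. *)
Lemma dioph_image (A B : Type) (LA : language A) (LB : language B) (d : A -> B)
    (V : finType) (P : (V -> A) -> Prop) :
  diophantine_map LA LB d -> dioph LA P ->
  dioph LB (fun w : V -> B => exists2 x, P x & w = d \o x).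
Proof.
move=> dd dP.
pose S : set (A ^ #|V|)%type := [set x | P (fun v => x (enum_rank v))].
have /dd/diophantineP : diophantine LA S.
  apply/diophantineP; apply: (eq_dioph _ (dioph_rename enum_rank dP)) => e.
  rewrite /S /=.
  suff -> : (fun v => [ffun i => e i] (enum_rank v)) = e \o enum_rank by [].
  by apply/funext => v; rewrite ffunE.
move=> /(dioph_rename (@enum_val V predT)); apply: eq_dioph => w; split.
- move=> [x Sx /ffunP E]; exists (fun v => x (enum_rank v)) => //.
  apply/funext => v /=; have := E (enum_rank v).
  by rewrite !ffunE /= enum_rankK.
- move=> [x Px ->]; exists [ffun i => x (enum_val i)].
    rewrite /S /=.
    suff -> : (fun v => [ffun i => x (enum_val i)] (enum_rank v)) = x by [].
    by apply/funext => v; rewrite ffunE enum_rankK.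
  by apply/ffunP => i; rewrite !ffunE.
Qed.

(** * Flattening families of vectors *)

Section Flattening.
Variables (R : Type) (L : language R) (k : nat).

Lemma first_coordE (x : (R ^ k)%type) (j : 'I_k) :
  val j = 0 -> first_coord L x = x j.
Proof.
move=> j0; rewrite /first_coord; case: insubP => [i _ i0|].
  by congr (x _); apply: val_inj; rewrite i0 j0.
by rewrite -{1}j0 ltn_ord.
Qed.

(** The vectors [e v] obtained from their coordinates. *)
Definition unflatten (V : Type) (e : V * 'I_k -> R) (v : V) : (R ^ k)%type :=
  [ffun j => e (v, j)].

(** The coordinates of the vectors [e v], as a single family. *)
Definition flatten_val (V : Type) (e : V -> (R ^ k)%type) (p : V * 'I_k) : R :=
  e p.1 p.2.

Lemma flatten_valK (V : Type) (e : V -> (R ^ k)%type) :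
  unflatten (flatten_val e) = e.
Proof. by apply/funext => v; apply/ffunP => j; rewrite ffunE. Qed.

(** The [j]-th coordinate of a function symbol applied to arguments given by
    their own coordinates. For [j = 0] the first coordinates of the arguments
    are their [j]-th ones. *)
Definition coord_fun (V : Type) (n : nat) (f : pow_fun L k n) :
    ('I_n -> 'I_k -> term L V) -> 'I_k -> term L V :=
  match f in pow_fun _ _ n
    return ('I_n -> 'I_k -> term L V) -> 'I_k -> term L V with
  | PowFun n f => fun ts j =>
      if val j == 0 then App f (fun i => ts i j) else Const V (lzero L)
  | PowProj l => fun ts j =>
      if val j == 0 then ts ord0 l else Const V (lzero L)
  end.

(** The [j]-th coordinate of a term over the power language. *)
Fixpoint coord_term (V : Type) (t : term (pow_language L k) V) :
    'I_k -> term L (V * 'I_k) :=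
  match t with
  | Var v => fun j => Var L (v, j)
  | Const c => fun j => @Const _ L _ (if val j == 0 then c else lzero L)
  | App n f ts => coord_fun (f : pow_fun L k n) (fun i => coord_term (ts i))
  end.

Lemma eval_coord_term (V : Type) (e : V * 'I_k -> R)
    (t : term (pow_language L k) V) (j : 'I_k) :
  eval e (coord_term t j) = eval (unflatten e) t j.
Proof.
elim: t j => [v|c|n f ts IH] j /=; rewrite ?ffunE //.
  by case: ifP.
case: f ts IH => [{}n f|l] ts IH /=; rewrite !ffunE; case: eqP => //= j0.
by congr ifun; apply/ffunP => i; rewrite !ffunE IH (first_coordE _ j0).
Qed.

Hypothesis k_gt0 : 0 < k.
Let j0 : 'I_k := Ordinal k_gt0.

Lemma first_coord_pad (x : R) : first_coord L (pad L k x) = x.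
Proof. by rewrite (@first_coordE _ j0) // ffunE. Qed.

Lemma pad_inj : injective (pad L k).
Proof.
by move=> x y /(congr1 (@first_coord _ L k)); rewrite !first_coord_pad.
Qed.

Lemma dioph_flatten_holds (V : Type) (f : basic_formula (pow_language L k) V) :
  dioph L (fun e => holds (unflatten e) f).
Proof.
case: f => n r; case: r => [{}n r|] ts /=.
- (* The relation must hold between the first coordinates, and all the other
     coordinates must vanish. *)
  apply: (@eq_dioph _ _ _ (fun e => forall j : 'I_k,
      if val j == 0 then irel r [ffun i => eval e (coord_term (ts i) j)]
      else forall i, eval e (coord_term (ts i) j) = iconst (lzero L))).
    move=> e; split=> [h|[x rx /ffunP E] j].
      exists [ffun i => eval e (coord_term (ts i) j0)]; first exact: (h j0).
      apply/ffunP => i; apply/ffunP => j; rewrite !ffunE.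
      case: eqP => [jE|/eqP jN].
        rewrite -eval_coord_term.
        by congr (eval _ (coord_term _ _)); apply: val_inj.
      by have := h j; rewrite (negPf jN) => /(_ i) <-; rewrite eval_coord_term.
    have {}E i : eval e (coord_term (ts i) j) = pad L k (x i) j.
      by have := E i; rewrite !ffunE eval_coord_term => <-; rewrite ffunE.
    case: eqP => [jE|/eqP jN] => [|i]; last by rewrite E ffunE (negPf jN).
    suff -> : [ffun i => eval e (coord_term (ts i) j)] = x by [].
    by apply/ffunP => i; rewrite ffunE E ffunE jE.
  apply: dioph_forall => j; case: eqP => _.
    exact: (dioph_holds (Basic r (fun i => coord_term (ts i) j))).
  by apply: dioph_forall => i; apply: (dioph_eval_eq _ (Const _ (lzero L))).
- apply: (@eq_dioph _ _ _ (fun e => forall j : 'I_k,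
      eval e (coord_term (ts ord0) j) = eval e (coord_term (ts ord_max) j))).
    move=> e; rewrite !ffunE; split=> [h|h j].
      by apply/ffunP => j; rewrite -!eval_coord_term.
    by rewrite !eval_coord_term h.
  by apply: dioph_forall => j; apply: dioph_eval_eq.
Qed.

Lemma dioph_flatten (V : Type) (P : (V -> (R ^ k)%type) -> Prop) :
  dioph (pow_language L k) P -> dioph L (fun e => P (unflatten e)).
Proof.
move=> [W [I [f Pf]]].
pose s (p : (V + W) * 'I_k) : V * 'I_k + W * 'I_k :=
  match p.1 with inl a => inl (a, p.2) | inr b => inr (b, p.2) end.
have E e y : unflatten (join e y \o s) = join (unflatten e) (unflatten y).
  by apply/funext => -[a|b]; apply/ffunP => j; rewrite !ffunE.
have := dioph_exists (dioph_forall (fun i =>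
  dioph_rename s (dioph_flatten_holds (f i)))).
apply: eq_dioph => e; rewrite Pf; split=> -[y h].
  by exists (unflatten y) => i; rewrite -E.
by exists (flatten_val y) => i; rewrite E flatten_valK.
Qed.

(** The term over the power language with value [(t, 0, ..., 0)]. *)
Fixpoint lift_term (V : Type) (t : term L (V * 'I_k)) :
    term (pow_language L k) V :=
  match t with
  | Var p => @App _ (pow_language L k) V 1 (PowProj L p.2) (fun=> Var _ p.1)
  | Const c => @Const _ (pow_language L k) V c
  | App n f ts =>
      @App _ (pow_language L k) V n (PowFun k f) (fun i => lift_term (ts i))
  end.

(** The formula over the power language that asserts [f] of the coordinates of
    the variables. *)
Definition lift_formula (V : Type) (f : basic_formula L (V * 'I_k)) :
    basic_formula (pow_language L k) V :=
  let: Basic n r ts := f in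
  @Basic _ (pow_language L k) V n (PowRel r)
    (fun i => lift_term (ts i)).

Lemma eval_lift_term (V : Type) (e : V -> (R ^ k)%type)
    (t : term L (V * 'I_k)) :
  eval e (lift_term t) = pad L k (eval (flatten_val e) t).
Proof.
elim: t => [p|c|n f ts IH] //=; first by rewrite ffunE.
congr (pad L k (ifun f _)).
by apply/ffunP => i; rewrite !ffunE IH first_coord_pad.
Qed.

Lemma holds_lift_formula (V : Type) (e : V -> (R ^ k)%type)
    (f : basic_formula L (V * 'I_k)) :
  holds e (lift_formula f) <-> holds (flatten_val e) f.
Proof.
case: f => n r ts /=; split=> [[x rx /ffunP E]|h].
  suff -> : [ffun i => eval (flatten_val e) (ts i)] = x by [].
  by apply/ffunP => i; apply: pad_inj; have := E i;
     rewrite !ffunE eval_lift_term.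
exists [ffun i => eval (flatten_val e) (ts i)] => //.
by apply/ffunP => i; rewrite !ffunE eval_lift_term.
Qed.

Lemma dioph_unflatten (V : Type) (P : (V * 'I_k -> R) -> Prop) :
  dioph L P -> dioph (pow_language L k) (fun e => P (flatten_val e)).
Proof.
move=> [W [I [f Pf]]].
(* An auxiliary variable of [R] becomes the first coordinate of one of
   [R ^ k]. *)
pose s (v : V * 'I_k + W) : (V + W) * 'I_k :=
  match v with inl p => (inl p.1, p.2) | inr b => (inr b, j0) end.
exists W, I, (fun i => lift_formula (rename_formula s (f i))) => e.
have E y : flatten_val (join e y) \o s =
    join (flatten_val e) (fun b => y b j0).
  by apply/funext; case.
rewrite Pf; split=> -[y h].
  exists (fun b => pad L k (y b)) => i; apply/holds_lift_formula/holds_rename.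
  rewrite E; suff -> : (fun b => pad L k (y b) j0) = y by [].
  by apply/funext => b; rewrite ffunE.
exists (fun b => y b j0) => i; rewrite -E.
exact/holds_rename/holds_lift_formula.
Qed.

End Flattening.

(** * Maps given by Diophantine expressions *)

Theorem proposition5p47 (R1 R2 : Type) (L1 : language R1) (L2 : language R2)
  (k k' : nat) (hk : 0 < k) (hk' : 0 < k')
  (d1 : R1 -> R2) (d2 : (R1 ^ k)%type -> (R2 ^ k')%type) :
  injective d1 ->
  diophantine_map L1 L2 d1 ->
  diophantine_expression L2 d1 d2 ->
  diophantine_map (pow_language L1 k) (pow_language L2 k') d2.
Proof.
move=> _ dd1 [n [l' [f d2E]]] m S /diophantineP /(dioph_flatten hk) dS.
have {}dS := dioph_image dd1 dS.
apply/diophantineP.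
pose Z := ('I_m * 'I_k')%type; pose X := ('I_m * 'I_k)%type.
(* The formulas that define [d2] hold, for some auxiliary values, at the [i]-th
   blocks of [w] and [z], where [e] is [join z w]. *)
pose graph (i : 'I_m) (e : Z + X -> R2) := exists y : 'I_l' -> R2, forall a,
  holds (fun v : 'I_k + 'I_l' + 'I_k' => match v with
    | inl (inl j) => e (inr (i, j)) | inl (inr b) => y b
    | inr j => e (inl (i, j)) end) (f a).
have dgraph i : dioph L2 (graph i).
  pose s (v : 'I_k + 'I_l' + 'I_k') : Z + X + 'I_l' := match v with
    | inl (inl j) => inl (inr (i, j)) | inl (inr b) => inr b
    | inr j => inl (inl (i, j)) end.
  have := dioph_exists (dioph_forall (fun a =>
    dioph_rename s (dioph_holds (f a)))).
  apply: eq_dioph => e.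
  suff E y : join e y \o s = fun v => match v with
      | inl (inl j) => e (inr (i, j)) | inl (inr b) => y b
      | inr j => e (inl (i, j)) end.
    by split=> -[y h]; exists y => a; move: (h a); rewrite E.
  by apply/funext => -[[]|].
have graphE i (x : X -> R1) (z : Z -> R2) :
    graph i (join z (d1 \o x)) <-> d2 (unflatten x i) = unflatten z i.
  rewrite d2E /graph; split=> -[y h].
    exists [ffun b => y b] => a; move: (h a).
    set g := (X in holds X _ -> _); set g' := (X in _ -> holds X _).
    suff -> : g = g' by [].
    by apply/funext => -[[j|b]|j]; rewrite /g /g' /= !ffunE.
  exists y => a; move: (h a).
  set g := (X in holds X _ -> _); set g' := (X in _ -> holds X _).
  suff -> : g = g' by [].
  by apply/funext => -[[j|b]|j]; rewrite /g /g' /= ?ffunE.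
have := dioph_unflatten hk' (dioph_exists (dioph_and
  (dioph_rename (inr : X -> Z + X) dS) (dioph_forall dgraph))).
apply: eq_dioph => z; split.
- move=> [w [[x Sx wE] gr]].
  exists [ffun i => unflatten x i] => //.
  apply/ffunP => i; rewrite !ffunE.
  have {}wE : w = d1 \o x by rewrite -wE; apply/funext.
  have /graphE : graph i (join (flatten_val z) (d1 \o x)) by rewrite -wE.
  by rewrite flatten_valK.
- move=> [x Sx /ffunP E].
  pose x' : X -> R1 := flatten_val (fun i => x i).
  exists (d1 \o x'); split.
    exists x' => //; rewrite flatten_valK.
    by have -> : [ffun i => x i] = x by apply/ffunP => i; rewrite ffunE.
  move=> i; apply/graphE; rewrite !flatten_valK.
  by have := E i; rewrite !ffunE.
Qed.
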